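(* Let $X$ be a countably infinite set and let $\mathcal{H}\subseteq 2^X$ be a VC finite hypothesis. Then for every $\epsilon>0$ there is an $m>0$ such that for all samples $f:\omega\to X$, $$S(\mathcal{H},f,m)\geq 1-\epsilon .$$ Moreover, for all samples $f:\omega\to X$, $$\lim_{m\to\infty}S(\mathcal{H},f,m)=1 .$$
   Context: $2^X$ is the set of functions $X\to\{0,1\}$; a hypothesis is a subset $\mathcal{H}\subseteq 2^X$. For $X_0\subseteq X$, $\mathcal{H}{\upharpoonright}_{X_0}=\{h{\upharpoonright}_{X_0}: h\in\mathcal{H}\}$; $\mathcal{H}$ shatters $X_0$ if $\mathcal{H}{\upharpoonright}_{X_0}=2^{X_0}$. $\mathcal{H}$ is VC finite if its VC dimension (the maximal size of a set shattered by $\mathcal{H}$) is finite, i.e. there is $d\in\omega$ such that every set shattered by $\mathcal{H}$ has at most $d$ elements. A sample of $X$ is an injective function $f:\omega\to X$. Write $[n]=\{0,\dots,n-1\}$. The surprise of $\mathcal{H}$ along $f$ at stage $n$ is $$S(\mathcal{H},f,n)=1-\frac{|\mathcal{H}{\upharpoonright}_{f([n])}|}{2^{|f([n])|}}.$$ *)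

(* Defs.v *)
From mathcomp Require Import all_boot all_order all_algebra.
From mathcomp Require Import finmap.
From mathcomp Require Import all_classical all_reals all_analysis.
Import Order.TTheory GRing.Theory Num.Theory.
Import numFieldNormedType.Exports.

Set Implicit Arguments.
Unset Strict Implicit.
Unset Printing Implicit Defensive.

Local Open Scope classical_set_scope.
Local Open Scope ring_scope.

(* A hypothesis on X is a set H : set (X -> bool), with bool standing for
   {0,1}.  The library function sigL restricts h : X -> bool to a function
   on the subtype of X carried by X0. *)
Definition hyp_restr (X : Type) (H : set (X -> bool)) (X0 : set X) :
    set (X0 -> bool) :=
  [set sigL X0 h | h in H].
Arguments hyp_restr {X} H X0.

Definition shatters (X : Type) (H : set (X -> bool)) (X0 : set X) : Prop :=
  hyp_restr H X0 = setT.

(* X0 ranges over all subsets of X, so this also rules out the shattering of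
   infinite sets. *)
Definition VC_finite (X : Type) (H : set (X -> bool)) : Prop :=
  exists d : nat, forall X0 : set X, shatters H X0 -> (X0 #<= `I_d)%card.

Definition countably_infinite (X : Type) : Prop := ([set: X] #= [set: nat])%card.

Definition sample (X : Type) (f : nat -> X) : Prop := injective f.

(* The cardinality of a finite set A is #|` fset_set A|.  On infinite sets
   fset_set has the junk value fset0, but f @` `I_n is finite, hence so is
   any set of bool-valued functions on it. *)
Definition surprise (R : realType) (X : choiceType) (H : set (X -> bool))
    (f : nat -> X) (n : nat) : R :=
  1 - #|` fset_set (hyp_restr H (f @` `I_n))|%:R
      / 2 ^+ #|` fset_set (f @` `I_n)|.

(* Main.v *)
Require Import Defs.
From mathcomp Require Import all_boot all_order all_algebra.
From mathcomp Require Import finmap.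
From mathcomp Require Import all_classical all_reals all_analysis.
Import Order.TTheory GRing.Theory Num.Theory.
Import numFieldNormedType.Exports.

Set Implicit Arguments.
Unset Strict Implicit.
Unset Printing Implicit Defensive.

Local Open Scope classical_set_scope.
Local Open Scope ring_scope.

(** Let [d] bound the size of the sets shattered by [H], and put [D = d + 1].
    No set of [D] points is shattered, so [H] induces at most [2 ^ D - 1] of
    the [2 ^ D] patterns on any [D] distinct points.  A pattern on a sequence
    of points is determined by its patterns on consecutive blocks; hence,
    cutting [m] sample points into [m %/ D] blocks of size [D] and a remainder,
    the proportion of patterns that [H] induces is at most
    [(1 - 2 ^- D) ^+ (m %/ D)]: one factor per block, and 1 for the remainder.
    This bound tends to 0 and does not depend on
    the sample, which gives both halves of the theorem.

    The combinatorics is done on [trace H u], a finite set of patterns over the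
    index type of [u] ([card_trace_cat], [card_trace_VC], [card_trace_blocks]);
    [card_hyp_restr_range] transports it to restrictions to sets of points. *)

(** Indexing patterns by positions instead of points keeps the blocks of a
    sample in types ['I_n] that do not depend on the sample. *)
Definition trace {X : Type} (H : set (X -> bool)) {I : finType} (u : I -> X) :
    {set {ffun I -> bool}} :=
  [set g : {ffun I -> bool} | `[< exists2 h, H h & forall i, g i = h (u i) >]]%SET.

Lemma traceP {X : Type} (H : set (X -> bool)) (I : finType) (u : I -> X)
    (g : {ffun I -> bool}) :
  reflect (exists2 h, H h & forall i, g i = h (u i)) (g \in trace H u).
Proof. by rewrite inE; exact: asboolP. Qed.

Section Patterns.
Context {X : Type} {I : finType} (u : I -> X).

Definition pattern (w : range u -> bool) : {ffun I -> bool} :=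
  [ffun i => w (SigSub (mem_set (imageT u i)))].

Lemma pattern_sigL (h : X -> bool) i : pattern (sigL (range u) h) i = h (u i).
Proof. by rewrite ffunE. Qed.

(** Every point of [range u] occupies some position. *)
Lemma pattern_inj : injective pattern.
Proof.
move=> v w /ffunP vw; apply/funext => -[x xu].
have [i _ uix] := set_mem xu; move: (vw i); rewrite !ffunE.
by rewrite (_ : SigSub _ = SigSub xu)//; exact/val_inj.
Qed.

Lemma trace_pattern (H : set (X -> bool)) :
  [set` trace H u] = pattern @` hyp_restr H (range u).
Proof.
apply/seteqP; split=> [g /= /traceP[h Hh gh]|_ [_ [h Hh <-] <-]].
  exists (sigL (range u) h); first by exists h.
  by apply/ffunP => i; rewrite pattern_sigL.
by apply/traceP; exists h => // i; rewrite pattern_sigL.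
Qed.

Lemma trace_setT_shatters (H : set (X -> bool)) :
  trace H u = [set: {ffun I -> bool}]%SET -> shatters H (range u).
Proof.
move=> HT; apply/seteqP; split=> // w _.
have : [set` trace H u] (pattern w) by rewrite HT /= finset.in_setT.
by rewrite trace_pattern => -[v Hv /pattern_inj <-].
Qed.

End Patterns.

Lemma card_eq_set_mem {T : finType} (A : {set T}) : ([set` A] #= `I_#|A|)%card.
Proof.
rewrite (card_eqr card_II) (_ : [set` A] = range (@enum_val T (mem A))).
  by apply: inj_card_eq => i j _ _; exact: enum_val_inj.
apply/seteqP; split=> [x /= xA|_ [i _ <-] /=]; last exact: enum_valP.
by exists (enum_rank_in xA x) => //; rewrite enum_rankK_in.
Qed.

Lemma card_hyp_restr_range {X : choiceType} (H : set (X -> bool))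
    (I : finType) (u : I -> X) :
  #|` fset_set (hyp_restr H (range u))| = #|trace H u|.
Proof.
apply: card_fset_set; rewrite -(card_eqr (card_eq_set_mem _)) trace_pattern.
by rewrite card_eq_sym; apply: inj_card_eq => v w _ _; exact: pattern_inj.
Qed.

(** Cutting a sequence of points in two loses nothing: the pair of patterns on
    the parts determines the pattern on the whole. *)
Lemma card_trace_cat {X : Type} (H : set (X -> bool)) (f : nat -> X) m n :
  (#|trace H (fun i : 'I_(m + n) => f i)| <=
   #|trace H (fun i : 'I_m => f i)| *
   #|trace H (fun i : 'I_n => f (m + i)%N)|)%N.
Proof.
pose cut (g : {ffun 'I_(m + n) -> bool}) :
    {ffun 'I_m -> bool} * {ffun 'I_n -> bool} :=
  ([ffun i => g (lshift n i)], [ffun i => g (rshift m i)]).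
have cut_inj : injective cut.
  move=> g g' [/ffunP gl /ffunP gr]; apply/ffunP => i.
  by case: (split_ordP i) => j ->; [move: (gl j)|move: (gr j)]; rewrite !ffunE.
rewrite -cardsX -(card_imset _ cut_inj); apply/subset_leq_card/fintype.subsetP.
move=> _ /imsetP[g /traceP[h Hh gh] ->]; rewrite inE /=.
by apply/andP; split; apply/traceP; exists h => // i; rewrite ffunE gh.
Qed.

(** If all patterns occurred, [d.+1] distinct points would be shattered. *)
Lemma card_trace_VC {X : Type} (H : set (X -> bool)) (d : nat) :
  (forall X0 : set X, shatters H X0 -> (X0 #<= `I_d)%card) ->
  forall u : 'I_d.+1 -> X, injective u ->
  (#|trace H u| <= (2 ^ d.+1).-1)%N.
Proof.
move=> Hd u u_inj; have card2 : #|{: {ffun 'I_d.+1 -> bool}}| = (2 ^ d.+1)%N.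
  by rewrite card_ffun card_bool card_ord.
rewrite -ltnS prednK ?expn_gt0// -card2 -cardsT.
apply: proper_card; rewrite properT; apply/eqP => /trace_setT_shatters /Hd.
have /card_le_eql -> : (range u #= `I_d.+1)%card.
  rewrite (card_eqr card_II).
  by apply: inj_card_eq => i j _ _; exact: u_inj.
by rewrite card_le_II ltnn.
Qed.

(** Iterating [card_trace_cat] over blocks of size [d.+1]; the sample is
    generalized because each step shifts it. *)
Lemma card_trace_blocks {X : Type} (H : set (X -> bool)) (d : nat) :
  (forall X0 : set X, shatters H X0 -> (X0 #<= `I_d)%card) ->
  forall k r (f : nat -> X), injective f ->
  (#|trace H (fun i : 'I_(k * d.+1 + r) => f i)| <=
   (2 ^ d.+1).-1 ^ k * 2 ^ r)%N.
Proof.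
move=> Hd k r; elim: k => [|k IHk] f f_inj.
  rewrite mul1n; apply: leq_trans (max_card _) _.
  by rewrite card_ffun card_bool card_ord.
have f_shift_inj : injective (fun n => f (d.+1 + n)%N).
  by move=> i j /f_inj /addnI.
rewrite mulSn -addnA expnS -mulnA.
apply: leq_trans (card_trace_cat H f d.+1 (k * d.+1 + r)) _.
apply: leq_mul; last exact: IHk f_shift_inj.
by apply: (card_trace_VC Hd) => i j /f_inj /val_inj.
Qed.

Lemma surpriseE (R : realType) (X : choiceType) (H : set (X -> bool))
    (f : nat -> X) (n : nat) : injective f ->
  surprise R H f n = 1 - #|trace H (fun i : 'I_n => f i)|%:R / 2 ^+ n.
Proof.
move=> f_inj; rewrite /surprise (_ : #|` fset_set (f @` `I_n)| = n); last first.
  by apply: card_fset_set; apply: inj_card_eq => i j _ _; exact: f_inj.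
rewrite (_ : f @` `I_n = range (fun i : 'I_n => f i)) ?card_hyp_restr_range//.
apply/seteqP; split=> [_ [i /= i_n <-]|_ [i _ <-]]; last by exists i => /=.
by exists (Ordinal i_n).
Qed.

Lemma surprise_le1 (R : realType) (X : choiceType) (H : set (X -> bool))
    (f : nat -> X) (n : nat) : surprise R H f n <= 1.
Proof. by rewrite /surprise gerBl divr_ge0// exprn_ge0. Qed.

(** Dividing [card_trace_blocks] by [2 ^ m] turns each block into a factor
    [((2 ^ D) - 1) / 2 ^ D], where [D = d.+1], while the remainder cancels. *)
Lemma surprise_ge (R : realType) (X : choiceType) (H : set (X -> bool))
    (d : nat) (f : nat -> X) (m : nat) :
  (forall X0 : set X, shatters H X0 -> (X0 #<= `I_d)%card) -> injective f ->
  1 - (1 - (2 ^+ d.+1)^-1) ^+ (m %/ d.+1) <= surprise R H f m.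
Proof.
move=> Hd f_inj; rewrite surpriseE// lerB// ler_pdivrMr ?exprn_gt0//.
move: (m %/ d.+1)%N (m %% d.+1)%N (divn_eq m d.+1) => k r ->.
have := card_trace_blocks Hd k r f_inj; rewrite -(ler_nat R).
move/le_trans; apply; rewrite natrM !natrX exprD mulnC exprM mulrA -exprMn.
rewrite mulrBl mul1r mulVf ?expf_neq0 ?pnatr_eq0//.
by rewrite -subn1 natrB ?expn_gt0// natrX.
Qed.

(** The lower bound of [surprise_ge] does not mention the sample, so a single
    stage serves all samples at once. *)
Lemma surprise_near1 (R : realType) (X : choiceType) (H : set (X -> bool))
    (eps : R) : VC_finite H -> 0 < eps ->
  \forall m \near \oo, forall f : nat -> X, sample f ->
    1 - eps <= surprise R H f m.
Proof.
move=> [d Hd] eps0; pose q : R := 1 - (2 ^+ d.+1)^-1.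
have q_lt1 : `|q| < 1.
  have q_ge0 : 0 <= q by rewrite subr_ge0 invf_le1 ?exprn_gt0// exprn_ege1// ler1n.
  by rewrite ger0_norm// gtrBl invr_gt0 exprn_gt0.
have /cvgrPdist_le/(_ _ eps0)[N _ qN] := cvg_expr q_lt1.
exists (N * d.+1)%N => // m /= Nm f f_inj.
apply: le_trans (surprise_ge R m Hd f_inj).
have := qN (m %/ d.+1)%N; rewrite /= leq_divRL// => /(_ Nm).
by rewrite sub0r normrN => /(le_trans (ler_norm _)) q_le; rewrite lerB.
Qed.

Theorem proposition1p5 (R : realType) (X : choiceType)
    (hX : countably_infinite X) (H : set (X -> bool)) (hH : VC_finite H) :
  (forall eps : R, 0 < eps ->
     exists m : nat, (0 < m)%N /\
       forall f : nat -> X, sample f -> 1 - eps <= surprise R H f m) /\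
  (forall f : nat -> X, sample f -> surprise R H f m @[m --> \oo] --> (1 : R)).
Proof.
split=> [eps eps0|f f_inj].
  have [N _ HN] := surprise_near1 hH eps0.
  by exists N.+1; split=> //; exact: HN N.+1 (leqnSn N).
apply/cvgrPdist_le => eps eps0.
apply: filterS (surprise_near1 hH eps0) => m /(_ f f_inj) S_ge.
by rewrite ger0_norm ?subr_ge0 ?surprise_le1// lerBlDr addrC -lerBlDr.
Qed.
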